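(* With $\overline{C}(\alpha)$ as defined in the context, $\overline{C}\left(\tfrac12\right)\ge 0.35047\,\pi^2$.
   Context: For a strictly increasing sequence $(\lambda_k)_{k=-\infty}^{\infty}$ of real numbers, put $\delta_k:=\min\{\lambda_k-\lambda_{k-1},\lambda_{k+1}-\lambda_k\}$. For $0\le\alpha\le2$, let $\overline{C}(\alpha)$ be the minimum of all constants $C(\alpha)$ such that $$\sum_{m=1}^N\sum_{\substack{n=1\\ n\ne m}}^N\frac{\delta_m^{2-\alpha}\delta_n^{\alpha}t_mt_n}{(\lambda_m-\lambda_n)^2}\le C(\alpha)\sum_{n=1}^N t_n^2$$ holds for every positive integer $N$, every strictly increasing real sequence $(\lambda_k)_{k\in\mathbb Z}$ and all nonnegative reals $t_1,\dots,t_N$; set $\overline{C}(\alpha)=\infty$ if no such real constant exists. *)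

(* Defs.v *)
From Stdlib Require Import Reals ZArith Arith.
Open Scope R_scope.

Fixpoint sum1 (N : nat) (f : nat -> R) : R :=
  match N with
  | O => 0
  | S n => sum1 n f + f (S n)
  end.

Definition strictly_increasing (lam : Z -> R) : Prop :=
  forall j k : Z, (j < k)%Z -> lam j < lam k.

Definition delta (lam : Z -> R) (k : Z) : R :=
  Rmin (lam k - lam (k - 1)%Z) (lam (k + 1)%Z - lam k).

Definition lhs_sum (alpha : R) (N : nat) (lam : Z -> R) (t : nat -> R) : R :=
  sum1 N (fun m => sum1 N (fun n =>
    if Nat.eq_dec n m then 0
    else Rpower (delta lam (Z.of_nat m)) (2 - alpha)
         * Rpower (delta lam (Z.of_nat n)) alpha * t m * t n
         / (lam (Z.of_nat m) - lam (Z.of_nat n)) ^ 2)).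

Definition admissible_const (alpha C : R) : Prop :=
  forall (N : nat) (lam : Z -> R) (t : nat -> R),
    strictly_increasing lam ->
    (forall n : nat, (1 <= n <= N)%nat -> 0 <= t n) ->
    lhs_sum alpha N lam t <= C * sum1 N (fun n => t n ^ 2).

(* Main.v *)
(* Write t_n = sqrt(delta_n) a_n, so that the form becomes
   sum delta_m delta_n (delta_m + delta_n) a_m a_n / (lambda_m - lambda_n)^2 over
   pairs m < n.  Equally spaced points give pi^2/3 in the limit; more is gained by
   alternating, periodically, five points at distance 1 from each other with an
   interval of length 6/5 filled by a very fine equally spaced grid.  As the mesh of
   the grid tends to 0, the grid alone contributes pi^2/3 times its share of the
   right-hand side, and it keeps a nontrivial interaction
   (delta_m^(3/2) delta_n^(1/2)) with the five isolated points.  Taking a_n constant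
   on each of twelve pieces of the interval, with values approximating the top
   eigenvector, the ratio is about 0.35052 pi^2.  Lengths are scaled by 20 below. *)

Require Import Defs.
From Stdlib Require Import Reals ZArith Arith.
From Stdlib Require Import List Lra Lia.
Import ListNotations.
Open Scope R_scope.

(** * Finite sums over index ranges and over lists *)

Lemma sum1_ext (N : nat) (f g : nat -> R) :
  (forall n, (1 <= n <= N)%nat -> f n = g n) -> sum1 N f = sum1 N g.
Proof.
  induction N as [|N IH]; intros H; simpl; [reflexivity|].
  rewrite IH, H; [reflexivity | lia | intros n Hn; apply H; lia].
Qed.

Lemma sum1_le (N : nat) (f g : nat -> R) :
  (forall n, (1 <= n <= N)%nat -> f n <= g n) -> sum1 N f <= sum1 N g.
Proof.
  induction N as [|N IH]; intros H; simpl; [lra|].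
  apply Rplus_le_compat; [apply IH; intros n Hn|]; apply H; lia.
Qed.

Lemma sum1_plus (N : nat) (f g : nat -> R) :
  sum1 N (fun n => f n + g n) = sum1 N f + sum1 N g.
Proof. induction N as [|N IH]; simpl; [|rewrite IH]; ring. Qed.

Lemma sum1_scal (N : nat) (c : R) (f : nat -> R) :
  sum1 N (fun n => c * f n) = c * sum1 N f.
Proof. induction N as [|N IH]; simpl; [|rewrite IH]; ring. Qed.

Lemma sum1_const (N : nat) (c : R) : sum1 N (fun _ => c) = INR N * c.
Proof. induction N as [|N IH]; [simpl; ring|]. rewrite S_INR; simpl; rewrite IH; ring. Qed.

Lemma sum1_head (N : nat) (f : nat -> R) :
  sum1 (S N) f = f 1%nat + sum1 N (fun n => f (S n)).
Proof.
  induction N as [|N IH]; [simpl; ring|].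
  change (sum1 (S (S N)) f) with (sum1 (S N) f + f (S (S N))).
  rewrite IH; simpl; ring.
Qed.

Lemma sum1_rev (N : nat) (f : nat -> R) :
  sum1 N (fun i => f (S N - i)%nat) = sum1 N f.
Proof.
  induction N as [|N IH]; [reflexivity|].
  rewrite sum1_head.
  rewrite (sum1_ext N _ (fun i => f (S N - i)%nat)) by (intros; f_equal; lia).
  rewrite IH; replace (S (S N) - 1)%nat with (S N) by lia; simpl; ring.
Qed.

Fixpoint sumL {A : Type} (f : A -> R) (l : list A) : R :=
  match l with
  | [] => 0
  | a :: l' => f a + sumL f l'
  end.

Lemma sumL_app {A : Type} (f : A -> R) (l l' : list A) :
  sumL f (l ++ l') = sumL f l + sumL f l'.
Proof. induction l as [|a l IH]; simpl; [|rewrite IH]; ring. Qed.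

Lemma sumL_map {A B : Type} (f : B -> R) (g : A -> B) (l : list A) :
  sumL f (map g l) = sumL (fun a => f (g a)) l.
Proof. induction l as [|a l IH]; simpl; [|rewrite IH]; reflexivity. Qed.

Lemma sumL_flat_map {A B : Type} (f : B -> R) (g : A -> list B) (l : list A) :
  sumL f (flat_map g l) = sumL (fun a => sumL f (g a)) l.
Proof. induction l as [|a l IH]; simpl; [|rewrite sumL_app, IH]; reflexivity. Qed.

Lemma sumL_ext {A : Type} (f g : A -> R) (l : list A) :
  (forall a, In a l -> f a = g a) -> sumL f l = sumL g l.
Proof.
  induction l as [|a l IH]; simpl; intros H; [reflexivity|].
  rewrite H, IH; auto.
Qed.

Lemma sumL_le {A : Type} (f g : A -> R) (l : list A) :
  (forall a, In a l -> f a <= g a) -> sumL f l <= sumL g l.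
Proof.
  induction l as [|a l IH]; simpl; intros H; [lra|].
  apply Rplus_le_compat; auto.
Qed.

Lemma sumL_plus {A : Type} (f g : A -> R) (l : list A) :
  sumL (fun a => f a + g a) l = sumL f l + sumL g l.
Proof. induction l as [|a l IH]; simpl; [|rewrite IH]; ring. Qed.

Lemma sumL_scal {A : Type} (c : R) (f : A -> R) (l : list A) :
  sumL (fun a => c * f a) l = c * sumL f l.
Proof. induction l as [|a l IH]; simpl; [|rewrite IH]; ring. Qed.

Lemma sumL_nonneg {A : Type} (f : A -> R) (l : list A) :
  (forall a, In a l -> 0 <= f a) -> 0 <= sumL f l.
Proof.
  induction l as [|a l IH]; simpl; intros H; [lra|].
  apply Rplus_le_le_0_compat; auto.
Qed.

Lemma sumL_swap {A B : Type} (f : A -> B -> R) (l : list A) (l' : list B) :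
  sumL (fun a => sumL (f a) l') l = sumL (fun b => sumL (fun a => f a b) l) l'.
Proof.
  induction l as [|a l IH]; simpl.
  - induction l' as [|b l' IH]; simpl; [|rewrite <- IH]; ring.
  - rewrite IH, <- sumL_plus; reflexivity.
Qed.

Lemma sum1_sumL {A : Type} (d : A) (f : A -> R) (l : list A) :
  sum1 (length l) (fun n => f (nth (pred n) l d)) = sumL f l.
Proof.
  induction l as [|a l IH]; [reflexivity|].
  cbn [length]; rewrite sum1_head; cbn [sumL pred nth].
  rewrite <- IH; f_equal; apply sum1_ext; intros [|n] Hn; [lia|reflexivity].
Qed.

(** * Finite weighted configurations: energy, mass, and the inequality between them *)

(* A point at [loc] carrying the weight [t = sqrt den * amp], where [den] is a
   lower bound for the corresponding delta; with this normalisation all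
   coefficients of the form are rational functions of the data. *)
Record point : Type := Point { loc : R; den : R; amp : R }.

Definition coupling (a b : point) : R :=
  den a * den b * (den a + den b) * (amp a * amp b) / (loc b - loc a) ^ 2.

Definition inter (l l' : list point) : R :=
  sumL (fun a => sumL (coupling a) l') l.

Fixpoint energy (l : list point) : R :=
  match l with
  | [] => 0
  | a :: l' => sumL (coupling a) l' + energy l'
  end.

Definition mass (l : list point) : R := sumL (fun a => den a * amp a ^ 2) l.

(** Read with [a] to the left of [b]. Imposed on all ordered pairs rather than on neighbours only,
    it passes directly to concatenations. *)
Definition apart (a b : point) : Prop :=
  den a <= loc b - loc a /\ den b <= loc b - loc a.

Definition valid (a : point) : Prop := 0 < den a /\ 0 <= amp a.

(** Splits off the row and the column of the first index, matching the recursion of [energy] on the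
    head of the list. *)
Lemma sum1_offdiag_head (N : nat) (h : nat -> nat -> R) :
  sum1 (S N) (fun m => sum1 (S N) (fun n => if Nat.eq_dec n m then 0 else h m n)) =
  sum1 N (fun n => h 1%nat (S n) + h (S n) 1%nat) +
  sum1 N (fun m => sum1 N (fun n =>
    if Nat.eq_dec n m then 0 else h (S m) (S n))).
Proof.
  rewrite sum1_head, sum1_head.
  rewrite (sum1_ext N (fun n => if Nat.eq_dec (S n) 1 then _ else _)
    (fun n => h 1%nat (S n))) by
    (intros n Hn; destruct (Nat.eq_dec (S n) 1); [lia|reflexivity]).
  rewrite (sum1_ext N (fun m => sum1 (S N) _) (fun m => h (S m) 1%nat +
    sum1 N (fun n => if Nat.eq_dec n m then 0 else h (S m) (S n)))).
  - rewrite !sum1_plus; simpl; ring.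
  - intros m Hm; rewrite sum1_head; f_equal.
    + destruct (Nat.eq_dec 1 (S m)); [lia|reflexivity].
    + apply sum1_ext; intros n Hn.
      destruct (Nat.eq_dec (S n) (S m)), (Nat.eq_dec n m); lia || reflexivity.
Qed.

Lemma energy_double_sum (d : point) (l : list point) :
  sum1 (length l) (fun m => sum1 (length l) (fun n =>
    if Nat.eq_dec n m then 0 else
    let a := nth (pred m) l d in let b := nth (pred n) l d in
    den a ^ 2 * den b * (amp a * amp b) / (loc a - loc b) ^ 2)) = energy l.
Proof.
  set (g := fun a b : point =>
    den a ^ 2 * den b * (amp a * amp b) / (loc a - loc b) ^ 2).
  change (sum1 (length l) (fun m => sum1 (length l) (fun n =>
    if Nat.eq_dec n m then 0 else g (nth (pred m) l d) (nth (pred n) l d)))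
    = energy l).
  induction l as [|a l IH]; [reflexivity|].
  cbn [length energy].
  rewrite (sum1_offdiag_head _
    (fun m n => g (nth (pred m) (a :: l) d) (nth (pred n) (a :: l) d))).
  rewrite <- IH; f_equal.
  - rewrite <- (sum1_sumL d); apply sum1_ext; intros [|n] Hn; [lia|].
    cbn [pred nth]; unfold g, coupling, Rdiv.
    set (b := nth n l d).
    replace ((loc a - loc b) ^ 2) with ((loc b - loc a) ^ 2) by ring; ring.
  - apply sum1_ext; intros [|m] Hm; [lia|].
    apply sum1_ext; intros [|n] Hn; [lia|reflexivity].
Qed.

Lemma ForallOrdPairs_nth {A : Type} (P : A -> A -> Prop) (d : A) (l : list A) :
  ForallOrdPairs P l ->
  forall i j, (i < j < length l)%nat -> P (nth i l d) (nth j l d).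
Proof.
  induction 1 as [|a l Ha Hl IH]; simpl; intros i j Hij; [lia|].
  destruct j as [|j]; [lia|]. destruct i as [|i].
  - rewrite Forall_forall in Ha; apply Ha, nth_In; lia.
  - apply IH; lia.
Qed.

Lemma strictly_increasing_of_step (lam : Z -> R) :
  (forall k : Z, lam k < lam (k + 1)%Z) -> strictly_increasing lam.
Proof.
  intros H j k Hjk.
  assert (Hn : forall n : nat, lam j < lam (j + Z.of_nat (S n))%Z).
  { induction n as [|n IH]; [apply H|].
    eapply Rlt_trans; [exact IH|].
    replace (j + Z.of_nat (S (S n)))%Z with (j + Z.of_nat (S n) + 1)%Z by lia.
    apply H. }
  replace k with (j + Z.of_nat (S (Z.to_nat (k - j - 1))))%Z by lia.
  apply Hn.
Qed.

(** Both exponents 3/2 and 1/2 are positive, so [Rpower] is monotone in its base and the true deltas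
    may be replaced by lower bounds. At equality the half powers combine to [d ^ 2 * e]. *)
Lemma Rpower_half_mul_sqrt (x y d e : R) :
  0 < d <= x -> 0 < e <= y ->
  d ^ 2 * e <= Rpower x (2 - 1/2) * Rpower y (1/2) * (sqrt d * sqrt e).
Proof.
  intros Hd He.
  assert (Hs : forall z, 0 < z -> sqrt z = Rpower z (1/2)).
  { intros z Hz; rewrite <- Rpower_sqrt by exact Hz; f_equal; lra. }
  assert (E : d ^ 2 * e = (Rpower d (2 - 1/2) * Rpower e (1/2)) * (sqrt d * sqrt e)).
  { rewrite !Hs by lra.
    transitivity ((Rpower d (2 - 1/2) * Rpower d (1/2)) *
                  (Rpower e (1/2) * Rpower e (1/2))); [|ring].
    rewrite <- !Rpower_plus.
    replace (2 - 1/2 + 1/2) with (INR 2) by (simpl; lra).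
    replace (1/2 + 1/2) with 1 by lra.
    rewrite Rpower_pow, Rpower_1 by lra; ring. }
  rewrite E.
  apply Rmult_le_compat_r; [apply Rmult_le_pos; apply sqrt_pos|].
  apply Rmult_le_compat; try (left; apply exp_pos); apply Rle_Rpower_l; lra.
Qed.

Lemma pow2_pos (x : R) : x <> 0 -> 0 < x ^ 2.
Proof. intros H; rewrite <- Rsqr_pow2; apply Rsqr_pos_lt; exact H. Qed.

(** The list is completed to a bi-infinite sequence and tested with [t = sqrt den * amp]. The terms
    (m, n) and (n, m) together dominate one [coupling], and the squares of the weights add up to
    [mass]. *)
Lemma energy_le_mass (C : R) (l : list point) :
  admissible_const (1/2) C -> ForallOrdPairs apart l -> Forall valid l ->
  energy l <= C * mass l.
Proof.
  intros HC Hsep Hpos.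
  (* A nonempty list supplies the default [p0] for [nth]. *)
  destruct l as [|p0 l0] eqn:El; [unfold mass; simpl; lra|].
  rewrite <- El in *.
  assert (Hlen : (1 <= length l)%nat) by (rewrite El; simpl; lia).
  clear El l0.
  set (a := fun k : Z => nth (Z.to_nat (k - 1)) l p0).
  set (N := Z.of_nat (length l)).
  (* A step exceeding every [den], used outside the list so that the deltas at its two ends stay at
     least [den]. *)
  set (G := 1 + sumL den l).
  rewrite Forall_forall in Hpos.
  assert (Hin : forall k, (1 <= k <= N)%Z -> In (a k) l).
  { intros k Hk; apply nth_In; lia. }
  assert (HG : forall p, In p l -> den p <= G).
  { assert (H : forall l', (forall p, In p l' -> 0 < den p) ->
      forall p, In p l' -> den p <= sumL den l').
    { induction l' as [|q l' IH]; simpl; intros H p []; subst.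
      - assert (0 <= sumL den l')
          by (apply sumL_nonneg; intros; apply Rlt_le; auto). lra.
      - specialize (IH (fun p h => H p (or_intror h)) p H0).
        assert (0 < den q) by auto. lra. }
    intros p Hp. assert (den p <= sumL den l).
    { apply H; [intros q Hq; apply Hpos; exact Hq|exact Hp]. }
    unfold G; lra. }
  assert (HG0 : 0 < G).
  { pose proof (HG (a 1%Z) (Hin 1%Z ltac:(lia))).
    pose proof (proj1 (Hpos _ (Hin 1%Z ltac:(lia)))). lra. }
  (* Arithmetic progressions of step [G] continue the points on both sides; the default value of [a]
     outside 1..N is never read. *)
  set (lam := fun k : Z =>
    if (k <=? 1)%Z then loc (a 1%Z) + IZR (k - 1) * G
    else if (N <=? k)%Z then loc (a N) + IZR (k - N) * G
    else loc (a k)).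
  assert (Hlam : forall k, (1 <= k <= N)%Z -> lam k = loc (a k)).
  { intros k Hk; unfold lam.
    destruct (Z.leb_spec k 1); [replace k with 1%Z by lia; simpl; ring|].
    destruct (Z.leb_spec N k); [replace k with N by lia|reflexivity].
    rewrite Z.sub_diag; ring. }
  assert (Hout : forall k, (k < 1 \/ N <= k)%Z -> lam (k + 1)%Z - lam k = G).
  { intros k [Hk|Hk]; unfold lam.
    - destruct (Z.leb_spec k 1), (Z.leb_spec (k+1) 1); try lia.
      replace (k + 1 - 1)%Z with (k - 1 + 1)%Z by lia; rewrite plus_IZR; ring.
    - destruct (Z.leb_spec k 1), (Z.leb_spec (k+1) 1), (Z.leb_spec N k),
        (Z.leb_spec N (k+1)); try lia.
      + replace N with 1%Z by lia. replace k with 1%Z by lia. simpl. ring.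
      + replace (k + 1 - N)%Z with (k - N + 1)%Z by lia; rewrite plus_IZR; ring. }
  assert (Hgap : forall k, (1 <= k < N)%Z ->
    den (a k) <= lam (k + 1)%Z - lam k /\ den (a (k + 1)%Z) <= lam (k + 1)%Z - lam k).
  { intros k Hk; rewrite !Hlam by lia.
    apply (ForallOrdPairs_nth apart p0 l Hsep); lia. }
  assert (Hinc : strictly_increasing lam).
  { apply strictly_increasing_of_step; intros k.
    destruct (Z_lt_dec k 1); [pose proof (Hout k ltac:(lia)); lra|].
    destruct (Z_le_dec N k); [pose proof (Hout k ltac:(lia)); lra|].
    pose proof (proj1 (Hgap k ltac:(lia))).
    pose proof (proj1 (Hpos _ (Hin k ltac:(lia)))). lra. }
  assert (Hdelta : forall k, (1 <= k <= N)%Z -> den (a k) <= delta lam k).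
  { intros k Hk; unfold delta; apply Rmin_glb.
    - destruct (Z.eq_dec k 1) as [->|].
      + pose proof (Hout 0%Z ltac:(lia)) as H; simpl in H |- *; rewrite H.
        apply HG, Hin; lia.
      + pose proof (proj2 (Hgap (k - 1)%Z ltac:(lia))) as H.
        replace (k - 1 + 1)%Z with k in H by lia; exact H.
    - destruct (Z.eq_dec k N) as [->|].
      + rewrite Hout by lia; apply HG, Hin; lia.
      + apply Hgap; lia. }
  pose (b := fun n : nat => nth (pred n) l p0).
  assert (Hab : forall n, (1 <= n)%nat -> a (Z.of_nat n) = b n).
  { intros n Hn; unfold a, b; f_equal; lia. }
  specialize (HC (length l) lam (fun n => sqrt (den (b n)) * amp (b n)) Hinc).
  assert (Hb : forall n, (1 <= n <= length l)%nat -> valid (b n)).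
  { intros n Hn; rewrite <- Hab by lia; apply Hpos, Hin; lia. }
  assert (Ht : forall n, (1 <= n <= length l)%nat ->
    0 <= sqrt (den (b n)) * amp (b n)).
  { intros n Hn; apply Rmult_le_pos; [apply sqrt_pos|apply Hb; exact Hn]. }
  specialize (HC Ht).
  replace (mass l) with
    (sum1 (length l) (fun n => (sqrt (den (b n)) * amp (b n)) ^ 2)).
  2:{ unfold mass; rewrite <- (sum1_sumL p0); apply sum1_ext; intros n Hn.
      rewrite Rpow_mult_distr, pow2_sqrt; [reflexivity|].
      apply Rlt_le, Hb; exact Hn. }
  eapply Rle_trans; [|exact HC].
  rewrite <- (energy_double_sum p0); unfold lhs_sum.
  apply sum1_le; intros m Hm; apply sum1_le; intros n Hn.
  destruct (Nat.eq_dec n m) as [|Hnm]; [lra|].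
  cbv zeta; fold (b m) (b n).
  rewrite !Hlam by lia; rewrite !Hab by lia.
  pose proof (Hdelta (Z.of_nat m) ltac:(lia)) as Dm.
  pose proof (Hdelta (Z.of_nat n) ltac:(lia)) as Dn.
  rewrite Hab in Dm, Dn by lia.
  destruct (Hb m Hm) as [Pm Am], (Hb n Hn) as [Pn An].
  pose proof (Rpower_half_mul_sqrt _ _ _ _ (conj Pm Dm) (conj Pn Dn)) as HR.
  apply Rmult_le_compat_r.
  - apply Rlt_le, Rinv_0_lt_compat, pow2_pos.
    assert (Hx : forall i j, (1 <= i < j)%nat -> (j <= length l)%nat ->
      loc (b i) < loc (b j)).
    { intros i j Hi Hj; rewrite <- !Hab, <- !Hlam by lia; apply Hinc; lia. }
    destruct (Nat.lt_total n m) as [H|[H|H]]; [|lia|].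
    + pose proof (Hx n m ltac:(lia) ltac:(lia)); lra.
    + pose proof (Hx m n ltac:(lia) ltac:(lia)); lra.
  - apply Rle_trans with (Rpower (delta lam (Z.of_nat m)) (2 - 1/2) *
      Rpower (delta lam (Z.of_nat n)) (1/2) * (sqrt (den (b m)) * sqrt (den (b n)))
      * (amp (b m) * amp (b n))); [|right; ring].
    apply Rmult_le_compat_r; [apply Rmult_le_pos; assumption|exact HR].
Qed.

(** * Concatenation, translation and periodic arrays *)

Lemma inter_app_l (l1 l2 l : list point) :
  inter (l1 ++ l2) l = inter l1 l + inter l2 l.
Proof. apply sumL_app. Qed.

Lemma energy_app (l l' : list point) :
  energy (l ++ l') = energy l + inter l l' + energy l'.
Proof.
  induction l as [|a l IH]; simpl; [unfold inter; simpl; ring|].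
  rewrite sumL_app, IH; unfold inter; simpl; ring.
Qed.

Definition translate (y : R) (p : point) : point := Point (loc p + y) (den p) (amp p).

Lemma translate_translate (y z : R) (l : list point) :
  map (translate z) (map (translate y) l) = map (translate (y + z)) l.
Proof.
  rewrite map_map; apply map_ext; intros p; unfold translate; simpl; f_equal; ring.
Qed.

Lemma inter_translate (y : R) (l l' : list point) :
  inter (map (translate y) l) (map (translate y) l') = inter l l'.
Proof.
  unfold inter; rewrite sumL_map; apply sumL_ext; intros a _.
  rewrite sumL_map; apply sumL_ext; intros b _.
  unfold coupling, translate; simpl; f_equal; f_equal; ring.
Qed.

Lemma energy_translate (y : R) (l : list point) : energy (map (translate y) l) = energy l.
Proof.
  induction l as [|a l IH]; simpl; [reflexivity|]; rewrite IH; f_equal.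
  rewrite sumL_map; apply sumL_ext; intros b _.
  unfold coupling, translate; simpl; f_equal; f_equal; ring.
Qed.

Lemma mass_app (l l' : list point) : mass (l ++ l') = mass l + mass l'.
Proof. apply sumL_app. Qed.

Lemma mass_translate (y : R) (l : list point) : mass (map (translate y) l) = mass l.
Proof. unfold mass; rewrite sumL_map; reflexivity. Qed.

Lemma valid_translate (y : R) (l : list point) :
  Forall valid l -> Forall valid (map (translate y) l).
Proof. intros H; apply Forall_map; exact H. Qed.

Lemma ForallOrdPairs_app {A : Type} (P : A -> A -> Prop) (l l' : list A) :
  ForallOrdPairs P l -> ForallOrdPairs P l' ->
  (forall a b, In a l -> In b l' -> P a b) -> ForallOrdPairs P (l ++ l').
Proof.
  induction 1 as [|a l Ha Hl IH]; simpl; intros H' H; [exact H'|].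
  constructor; [|apply IH; auto].
  apply Forall_app; split; [exact Ha|].
  apply Forall_forall; auto.
Qed.

Lemma apart_translate (y : R) (l : list point) :
  ForallOrdPairs apart l -> ForallOrdPairs apart (map (translate y) l).
Proof.
  induction 1 as [|a l Ha Hl IH]; simpl; constructor; [|exact IH].
  apply Forall_map; eapply Forall_impl; [|exact Ha].
  intros b [H1 H2]; split; unfold translate; simpl; lra.
Qed.

Fixpoint array (P : list point) (L : R) (K : nat) : list point :=
  match K with
  | O => []
  | S k => array P L k ++ map (translate (INR k * L)) P
  end.

Lemma in_array (P : list point) (L : R) (K : nat) (p : point) :
  In p (array P L K) ->
  exists i q, (i < K)%nat /\ In q P /\ p = translate (INR i * L) q.
Proof.
  induction K as [|K IH]; cbn [array]; [intros []|].
  intros H; apply in_app_or in H as [H|H].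
  - destruct (IH H) as (i & q & Hi & Hq); exists i, q; split; [lia|exact Hq].
  - apply in_map_iff in H as (q & <- & Hq); exists K, q; auto.
Qed.

Lemma mass_array (P : list point) (L : R) (K : nat) :
  mass (array P L K) = INR K * mass P.
Proof.
  induction K as [|K IH]; [unfold mass; simpl; ring|].
  rewrite S_INR; cbn [array]; rewrite mass_app, mass_translate, IH; ring.
Qed.

Lemma valid_array (P : list point) (L : R) (K : nat) :
  Forall valid P -> Forall valid (array P L K).
Proof.
  intros H; induction K as [|K IH]; cbn [array]; [constructor|].
  apply Forall_app; split; [exact IH|apply valid_translate; exact H].
Qed.

Lemma apart_array (P : list point) (L : R) (K : nat) :
  0 <= L -> ForallOrdPairs apart P ->
  (forall a b, In a P -> In b P -> apart a (translate L b)) ->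
  ForallOrdPairs apart (array P L K).
Proof.
  intros HL HP H; induction K as [|K IH]; cbn [array]; [constructor|].
  apply ForallOrdPairs_app; [exact IH|apply apart_translate; exact HP|].
  intros a b Ha Hb.
  apply in_array in Ha as (i & a' & Hi & Ha' & ->).
  apply in_map_iff in Hb as (b' & <- & Hb').
  destruct (H a' b' Ha' Hb') as [H1 H2]; unfold apart, translate in *; simpl in *.
  assert (INR i * L + L <= INR K * L).
  { assert (Hi' : INR (S i) <= INR K) by (apply le_INR; lia).
    rewrite S_INR in Hi'; nra. }
  lra.
Qed.

(* The energy of [k + 1] periods exceeds that of [k] periods by this amount. *)
Definition period_energy (P : list point) (L : R) (k : nat) : R :=
  energy P + sum1 k (fun d => inter P (map (translate (INR d * L)) P)).

(** A new last period adds its own energy and its interaction with each earlier one. By translation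
    invariance the latter depends only on the number of periods between them, so reversing the
    summation gives a sum over that distance. *)
Lemma energy_array (P : list point) (L : R) (K : nat) :
  energy (array P L K) = sum1 K (fun k => period_energy P L (pred k)).
Proof.
  induction K as [|K IH]; [reflexivity|].
  cbn [array sum1 pred]; rewrite energy_app, energy_translate, IH.
  unfold period_energy; rewrite Rplus_assoc; f_equal; rewrite Rplus_comm; f_equal.
  rewrite <- sum1_rev; clear IH.
  assert (H : forall k, (k <= K)%nat ->
    inter (array P L k) (map (translate (INR K * L)) P) =
    sum1 k (fun i => inter P (map (translate (INR (S K - i) * L)) P))).
  { induction k as [|k IH]; intros Hk; [reflexivity|].
    cbn [array sum1]; rewrite inter_app_l, IH by lia; f_equal.
    replace (INR K * L) with (INR (S K - S k) * L + INR k * L).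
    - rewrite <- translate_translate; apply inter_translate.
    - rewrite <- Rmult_plus_distr_r, <- plus_INR; do 2 f_equal; lia. }
  apply H; lia.
Qed.

(** * Averages over many periods and tails of series *)

(** From some index [D] on, every term is at least [E + eta]. The earlier terms are nonnegative, and
    the surplus [eta] of sufficiently many later terms makes up for the at most [D * E] missing from
    them. *)
Lemma cesaro_lower_bound (T : nat -> R) (E0 E G : R) (N0 : nat) :
  (forall k, 0 <= T k) -> 0 <= G ->
  (forall k, (N0 <= k)%nat -> E0 - G / (INR k + 1) <= T k) -> E < E0 ->
  exists K, (1 <= K)%nat /\ INR K * E <= sum1 K (fun k => T (pred k)).
Proof.
  intros HT HG Hlow HE.
  (* Half of the slack absorbs [G / (k + 1)]; the other half remains as surplus. *)
  set (eta := (E0 - E) / 2).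
  assert (Heta : 0 < eta) by (unfold eta; lra).
  destruct (INR_unbounded (G / eta)) as [D1 HD1].
  set (D := Nat.max N0 D1).
  assert (HD : forall k, (D <= k)%nat -> E + eta <= T k).
  { intros k Hk; eapply Rle_trans; [|apply Hlow; unfold D in Hk; lia].
    assert (Hk1 : INR D1 <= INR k) by (apply le_INR; unfold D in Hk; lia).
    pose proof (pos_INR D1).
    assert (G / (INR k + 1) <= eta).
    { apply Rmult_le_reg_r with (INR k + 1); [lra|].
      replace (G / (INR k + 1) * (INR k + 1)) with (G / eta * eta) by (field; lra).
      rewrite (Rmult_comm eta); apply Rmult_le_compat_r; lra. }
    unfold eta in *; lra. }
  assert (Hsum : forall j, INR j * (E + eta) <= sum1 (D + j) (fun k => T (pred k))).
  { induction j as [|j IH].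
    - rewrite Nat.add_0_r; simpl INR; rewrite Rmult_0_l.
      rewrite <- (Rmult_0_r (INR D)), <- sum1_const; apply sum1_le; auto.
    - rewrite Nat.add_succ_r, S_INR; cbn [sum1 pred].
      pose proof (HD (D + j)%nat ltac:(lia)); lra. }
  destruct (INR_unbounded (INR D * E / eta)) as [j Hj].
  exists (D + S j)%nat; split; [lia|].
  eapply Rle_trans; [|apply Hsum].
  rewrite plus_INR, S_INR.
  assert (INR D * E <= INR j * eta).
  { replace (INR D * E) with (INR D * E / eta * eta) by (field; lra).
    apply Rmult_le_compat_r; lra. }
  lra.
Qed.

(* The tail of a sum dominated by [c / (d + 1)^2] telescopes. *)
Lemma sum1_tail_lower_bound (f : nat -> R) (c : R) (D k : nat) :
  0 <= c -> (forall d, (D < d)%nat -> c / (INR d + 1) ^ 2 <= f d) -> (D <= k)%nat ->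
  sum1 D f + c / (INR D + 2) - c / (INR k + 2) <= sum1 k f.
Proof.
  intros Hc Hf; induction 1 as [|k Hk IH]; [lra|].
  cbn [sum1]; specialize (Hf (S k) ltac:(lia)); rewrite S_INR in *.
  pose proof (pos_INR k).
  assert (c / (INR k + 2) - c / (INR k + 1 + 2) <= c / (INR k + 1 + 1) ^ 2); [|lra].
  replace (c / (INR k + 2) - c / (INR k + 1 + 2)) with
    (c * / ((INR k + 2) * (INR k + 3))) by (field; lra).
  apply Rmult_le_compat_l; [exact Hc|].
  apply Rinv_le_contravar; nra.
Qed.

(** * Structure and positivity of the interaction *)

Lemma inter_flat_map_l {A : Type} (f : A -> list point) (l : list A) (m : list point) :
  inter (flat_map f l) m = sumL (fun a => inter (f a) m) l.
Proof. apply sumL_flat_map. Qed.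

Lemma inter_flat_map_r {A : Type} (f : A -> list point) (l : list A) (m : list point) :
  inter m (flat_map f l) = sumL (fun a => inter m (f a)) l.
Proof.
  unfold inter; rewrite <- (sumL_swap (fun p a => sumL (coupling p) (f a))).
  apply sumL_ext; intros p _; apply sumL_flat_map.
Qed.

Lemma map_flat_map {A B C : Type} (g : B -> C) (f : A -> list B) (l : list A) :
  map g (flat_map f l) = flat_map (fun a => map g (f a)) l.
Proof. induction l as [|a l IH]; simpl; [|rewrite map_app, IH]; reflexivity. Qed.

Lemma translate_0 (l : list point) : map (translate 0) l = l.
Proof.
  rewrite <- (map_id l) at 2; apply map_ext; intros [x d a].
  unfold translate; simpl; f_equal; ring.
Qed.

(** At [x = 0] this rests on the convention [/ 0 = 0], so [coupling_nonneg] covers coincident points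
    too. *)
Lemma inv_pow2_nonneg (x : R) : 0 <= / x ^ 2.
Proof.
  destruct (Req_dec x 0) as [->|Hx].
  - rewrite pow_i, Rinv_0 by lia; lra.
  - apply Rlt_le, Rinv_0_lt_compat, pow2_pos, Hx.
Qed.

Lemma coupling_nonneg (a b : point) : valid a -> valid b -> 0 <= coupling a b.
Proof.
  intros [Ha Ha'] [Hb Hb']; unfold coupling, Rdiv.
  apply Rmult_le_pos; [|apply inv_pow2_nonneg].
  apply Rmult_le_pos; [|apply Rmult_le_pos; assumption].
  apply Rmult_le_pos; [apply Rmult_le_pos|]; lra.
Qed.

(** * Equally spaced blocks of width 2 *)

(** The midpoints of [M] equal subintervals of [-1, 1], with the mesh as [den]. Blocks whose centres
    differ by 2 therefore continue one another as a single grid. *)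
Definition block (M : nat) (u : R) : list point :=
  array [Point (-1 + 1 / INR M) (2 / INR M) u] (2 / INR M) M.

Lemma in_block (M : nat) (u : R) (p : point) :
  In p (block M u) ->
  den p = 2 / INR M /\ amp p = u /\
  -1 + 1 / INR M <= loc p <= 1 - 1 / INR M.
Proof.
  intros H; apply in_array in H as (i & q & Hi & [<-|[]] & ->); simpl.
  split; [reflexivity|split; [reflexivity|]].
  assert (Hi' : INR (S i) <= INR M) by (apply le_INR; lia).
  rewrite S_INR in Hi'; pose proof (pos_INR i).
  assert (0 < / INR M) by (apply Rinv_0_lt_compat; lra).
  assert (INR M * / INR M = 1) by (field; lra).
  unfold Rdiv; split; nra.
Qed.

Lemma valid_block (M : nat) (u : R) : (1 <= M)%nat -> 0 <= u -> Forall valid (block M u).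
Proof.
  intros HM Hu; apply valid_array; constructor; [|constructor].
  split; simpl; [|exact Hu].
  apply Rdiv_lt_0_compat; [lra|apply lt_0_INR; lia].
Qed.

Lemma apart_block (M : nat) (u : R) : (1 <= M)%nat -> ForallOrdPairs apart (block M u).
Proof.
  intros HM.
  assert (0 < 2 / INR M) by (apply Rdiv_lt_0_compat; [lra|apply lt_0_INR; lia]).
  apply apart_array; [lra|repeat constructor|].
  intros a b [<-|[]] [<-|[]]; unfold apart, translate; simpl; lra.
Qed.

Lemma mass_block (M : nat) (u : R) : (1 <= M)%nat -> mass (block M u) = 2 * u ^ 2.
Proof.
  intros HM; unfold block; rewrite mass_array; unfold mass; simpl.
  field; apply not_0_INR; lia.
Qed.

(** With mesh h, a pair [d] steps apart contributes 2 h^3 u^2 / (d h)^2 = h u^2 * 2 / d^2. The mean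
    over [k] of the inner sums tends to 2 zeta(2) = pi^2/3, so the limit is pi^2/3 times the
    mass. *)
Lemma energy_block (M : nat) (u : R) : (1 <= M)%nat ->
  energy (block M u) = 2 / INR M * u ^ 2 *
    sum1 M (fun k => sum1 (pred k) (fun d => 2 / INR d ^ 2)).
Proof.
  intros HM; assert (0 < INR M) by (apply lt_0_INR; lia).
  unfold block; rewrite energy_array, <- sum1_scal.
  apply sum1_ext; intros k _; unfold period_energy; simpl energy.
  rewrite <- sum1_scal, !Rplus_0_l; apply sum1_ext; intros d Hd.
  assert (0 < INR d) by (apply lt_0_INR; lia).
  unfold inter, coupling, translate; simpl; field; repeat split; lra.
Qed.

(** The graph of the convex function 1/y^2 lies above its tangent at [c]. *)
Lemma tangent_inv_sq (c y : R) :
  0 < c -> 0 < y -> / c ^ 2 - 2 * (y - c) / c ^ 3 <= / y ^ 2.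
Proof.
  intros Hc Hy.
  assert (/ y ^ 2 - (/ c ^ 2 - 2 * (y - c) / c ^ 3) =
    (y - c) ^ 2 * (2 * y + c) * / (y ^ 2 * c ^ 3)) by (field; lra).
  assert (0 <= (y - c) ^ 2 * (2 * y + c) * / (y ^ 2 * c ^ 3)); [|lra].
  apply Rmult_le_pos; [apply Rmult_le_pos; [apply pow2_ge_0|lra]|].
  apply Rlt_le, Rinv_0_lt_compat, Rmult_lt_0_compat; apply pow_lt; assumption.
Qed.

Lemma sumL_loc_array (p : point) (L : R) (K : nat) :
  sumL loc (array [p] L K) = INR K * loc p + L * (INR K * (INR K - 1) / 2).
Proof.
  induction K as [|K IH]; [simpl; field|].
  rewrite S_INR; cbn [array]; rewrite sumL_app, IH; simpl; field.
Qed.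

Lemma sumL_const_array (p : point) (c L : R) (K : nat) :
  sumL (fun _ => c) (array [p] L K) = INR K * c.
Proof.
  induction K as [|K IH]; [simpl; ring|].
  rewrite S_INR; cbn [array]; rewrite sumL_app, IH; simpl; ring.
Qed.

(* By convexity, spreading a block of points around its centre can only
   increase its interaction with a point outside. *)
Lemma block_inv_sq (M : nat) (u c e : R) :
  (1 <= M)%nat -> 1 <= c -> -1 <= e <= 1 ->
  2 / c ^ 2 <= sumL (fun p => den p * / (c + e * loc p) ^ 2) (block M u).
Proof.
  intros HM Hc He; assert (HM' : 0 < INR M) by (apply lt_0_INR; lia).
  assert (Hi : 0 < 1 / INR M) by (apply Rdiv_lt_0_compat; lra).
  eapply Rle_trans; [|apply sumL_le with
    (f := fun p => 2 / INR M * / c ^ 2 + (2 / INR M * (- 2 * e / c ^ 3)) * loc p)].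
  (* The locations in a block sum to 0, so the linear term of the tangent vanishes. *)
  - rewrite sumL_plus, (sumL_scal _ loc); unfold block.
    rewrite sumL_loc_array, sumL_const_array; simpl loc.
    right; field; split; lra.
  - intros p Hp; apply in_block in Hp as (-> & _ & Hl).
    assert (Hy : 0 < c + e * loc p) by nra.
    pose proof (tangent_inv_sq c _ ltac:(lra) Hy) as H.
    replace (c + e * loc p - c) with (e * loc p) in H by ring.
    apply Rle_trans with (2 / INR M * (/ c ^ 2 - 2 * (e * loc p) / c ^ 3)).
    + right; field; split; lra.
    + apply Rmult_le_compat_l; [unfold Rdiv in *; lra|exact H].
Qed.

(** * Cells and lower bounds for their interactions *)

(* Depending on [fine], a cell is a block of width 2 or a single point with [den = 20]. *)
Record cell : Type := Cell { ctr : Z; fine : bool; wgt : Z }.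

Definition proto (M : nat) (A : cell) : list point :=
  if fine A then block M (IZR (wgt A)) else [Point 0 20 (IZR (wgt A))].

Definition expand (M : nat) (A : cell) : list point :=
  map (translate (IZR (ctr A))) (proto M A).

(** Centre distances that force [apart] for every [M]; 21 is the spacing 20 of an isolated point
    plus the half-width 1 of a block. *)
Definition gap (A B : cell) : Z :=
  match fine A, fine B with
  | false, false => 20
  | true, true => 2
  | _, _ => 21
  end.

(** Here 16000 = 20 * 20 * (20 + 20). In the mixed case 800 = 20 * 20 * 2 uses the total length 2 of
    a block and keeps only 20 from [den a + den b]. Interaction between distinct blocks is bounded
    below by 0, its limit as the mesh shrinks. *)
Definition coef (A B : cell) : Z :=
  match fine A, fine B with
  | false, false => 16000 * (wgt A * wgt B)
  | true, true => 0
  | _, _ => 800 * (wgt A * wgt B)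
  end.

Definition cell_coupling (y : R) (A B : cell) : R :=
  IZR (coef A B) / (IZR (ctr B) + y - IZR (ctr A)) ^ 2.

Lemma valid_expand (M : nat) (A : cell) :
  (1 <= M)%nat -> (0 <= wgt A)%Z -> Forall valid (expand M A).
Proof.
  intros HM HA; apply IZR_le in HA; apply valid_translate; unfold proto.
  destruct (fine A); [apply valid_block; assumption|].
  constructor; [split; simpl; lra|constructor].
Qed.

Lemma apart_expand (M : nat) (A : cell) :
  (1 <= M)%nat -> ForallOrdPairs apart (expand M A).
Proof.
  intros HM; apply apart_translate; unfold proto.
  destruct (fine A); [apply apart_block; exact HM|repeat constructor].
Qed.

Lemma mass_expand (M : nat) (A : cell) : (1 <= M)%nat ->
  mass (expand M A) = IZR ((if fine A then 2 else 20) * wgt A ^ 2).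
Proof.
  intros HM; unfold expand; rewrite mass_translate; unfold proto.
  rewrite Z.pow_2_r, !mult_IZR.
  destruct (fine A); [rewrite mass_block by exact HM|unfold mass]; simpl; ring.
Qed.

Lemma apart_cells (M : nat) (y : R) (A B : cell) (a b : point) :
  (1 <= M)%nat -> IZR (gap A B) <= IZR (ctr B) + y - IZR (ctr A) ->
  In a (expand M A) -> In b (map (translate y) (expand M B)) -> apart a b.
Proof.
  intros HM Hg Ha Hb; unfold expand in *; rewrite translate_translate in Hb.
  apply in_map_iff in Ha as (a' & <- & Ha); apply in_map_iff in Hb as (b' & <- & Hb).
  assert (HM' : 1 <= INR M) by (apply (le_INR 1); exact HM).
  assert (Hi : 0 < / INR M <= 1).
  { split; [apply Rinv_0_lt_compat; lra|].
    rewrite <- Rinv_1; apply Rinv_le_contravar; lra. }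
  unfold apart, translate, proto, gap in *; simpl.
  destruct (fine A), (fine B);
  repeat match goal with
  | H : In _ (block _ _) |- _ => apply in_block in H as (-> & _ & ?)
  | H : In _ [_] |- _ => destruct H as [<-|[]]
  end; unfold Rdiv in *; simpl in *; lra.
Qed.

(** The mixed cases concentrate the block at its centre by [block_inv_sq], with [e] equal to -1 or 1
    according to the side on which the block lies. *)
Lemma inter_cells (M : nat) (y : R) (A B : cell) :
  (1 <= M)%nat -> (0 <= wgt A)%Z -> (0 <= wgt B)%Z ->
  IZR (gap A B) <= IZR (ctr B) + y - IZR (ctr A) ->
  cell_coupling y A B <= inter (expand M A) (map (translate y) (expand M B)).
Proof.
  intros HM HA HB Hg.
  assert (HM' : 0 < INR M) by (apply lt_0_INR; lia).
  assert (Hi : 0 < 2 / INR M) by (apply Rdiv_lt_0_compat; lra).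
  pose proof (valid_expand M A HM HA) as VA.
  pose proof (valid_translate y _ (valid_expand M B HM HB)) as VB.
  unfold cell_coupling, coef, gap in *.
  set (c := IZR (ctr B) + y - IZR (ctr A)) in *.
  apply IZR_le in HA, HB; assert (Hw : 0 <= IZR (wgt A) * IZR (wgt B)) by
    (apply Rmult_le_pos; assumption).
  destruct (fine A) eqn:FA, (fine B) eqn:FB.
  - unfold Rdiv; rewrite Rmult_0_l.
    rewrite Forall_forall in VA, VB.
    apply sumL_nonneg; intros a Ha; apply sumL_nonneg; intros b Hb.
    apply coupling_nonneg; auto.
  - pose proof (block_inv_sq M (IZR (wgt A)) c (-1) HM ltac:(lra) ltac:(lra)) as H.
    apply Rmult_le_compat_l with (r := 400 * (IZR (wgt A) * IZR (wgt B))) in H; [|lra].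
    rewrite !mult_IZR.
    eapply Rle_trans; [|eapply Rle_trans; [exact H|]].
    + right; field; lra.
    + rewrite <- sumL_scal.
      unfold inter, expand, proto; rewrite FA, FB, sumL_map.
      apply sumL_le; intros p Hp; apply in_block in Hp as (Hd & Ha & Hl).
      simpl; unfold coupling, translate, Rdiv; simpl loc; simpl den; simpl amp.
      rewrite Hd, Ha, Rplus_0_r.
      replace (0 + IZR (ctr B) + y - (loc p + IZR (ctr A))) with (c + -1 * loc p)
        by (unfold c; ring).
      rewrite <- Rmult_assoc; apply Rmult_le_compat_r.
      * apply inv_pow2_nonneg.
      (* The discarded part is [20 * h * h] times the product of the weights, from the mesh in the
         factor [den a + den b]. *)
      * set (h := 2 / INR M) in *; fold (Rdiv 2 (INR M)); fold h.
        assert (0 <= h * h * (IZR (wgt A) * IZR (wgt B))) by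
          (apply Rmult_le_pos; [nra|lra]). lra.
  - pose proof (block_inv_sq M (IZR (wgt B)) c 1 HM ltac:(lra) ltac:(lra)) as H.
    apply Rmult_le_compat_l with (r := 400 * (IZR (wgt A) * IZR (wgt B))) in H; [|lra].
    rewrite !mult_IZR.
    eapply Rle_trans; [|eapply Rle_trans; [exact H|]].
    + right; field; lra.
    + rewrite <- sumL_scal.
      unfold inter, expand, proto; rewrite FA, FB; simpl sumL at 2; rewrite Rplus_0_r.
      rewrite !sumL_map.
      apply sumL_le; intros p Hp; apply in_block in Hp as (Hd & Ha & Hl).
      unfold coupling, translate, Rdiv; simpl loc; simpl den; simpl amp.
      rewrite Hd, Ha.
      replace (loc p + IZR (ctr B) + y - (0 + IZR (ctr A))) with (c + 1 * loc p)
        by (unfold c; ring).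
      rewrite <- Rmult_assoc; apply Rmult_le_compat_r.
      * apply inv_pow2_nonneg.
      * set (h := 2 / INR M) in *; fold (Rdiv 2 (INR M)); fold h.
        assert (0 <= h * h * (IZR (wgt A) * IZR (wgt B))) by
          (apply Rmult_le_pos; [nra|lra]). lra.
  - rewrite !mult_IZR; unfold inter, expand, proto, coupling, translate; rewrite FA, FB; simpl.
    right; unfold c; field; unfold c in Hg; lra.
Qed.

(** Note that 0.5236 = 3.1416 / 6. If the bound failed, sin(0.5236) would be below sin(pi/6) = 1/2,
    while the Taylor polynomial of degree 7, a lower bound for sine there, already exceeds 1/2. *)
Lemma PI_le : PI <= 31416 / 10000.
Proof.
  destruct (Rle_lt_dec PI (31416 / 10000)) as [H|H]; [exact H|exfalso].
  assert (Hs : sin (5236 / 10000) < sin (PI / 6)).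
  { apply sin_increasing_1; lra. }
  rewrite sin_PI6 in Hs.
  destruct (pre_sin_bound (5236 / 10000) 1 ltac:(lra) ltac:(lra)) as [Hl _].
  unfold sin_approx, sin_term in Hl; simpl in Hl.
  lra.
Qed.

(** * One period of cells and its interaction with later periods *)

Definition period (M : nat) (cells : list cell) : list point :=
  flat_map (expand M) cells.

(** The parameter [r] stands for a lower bound on the mean of the inner sums in [energy_block], so
    that the estimate no longer mentions [M]. *)
Definition cell_energy (r : R) (A : cell) : R :=
  if fine A then 2 * r * IZR (wgt A) ^ 2 else 0.

Fixpoint cells_energy (r : R) (cells : list cell) : R :=
  match cells with
  | [] => 0
  | A :: l => cell_energy r A + sumL (cell_coupling 0 A) l + cells_energy r l
  end.

Lemma cells_energy_le (M : nat) (r : R) (cells : list cell) :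
  (1 <= M)%nat ->
  INR M * r <= sum1 M (fun k => sum1 (pred k) (fun d => 2 / INR d ^ 2)) ->
  Forall (fun A => (0 <= wgt A)%Z) cells ->
  ForallOrdPairs (fun A B => (gap A B <= ctr B - ctr A)%Z) cells ->
  cells_energy r cells <= energy (period M cells).
Proof.
  intros HM Hr; assert (HM' : 0 < INR M) by (apply lt_0_INR; lia).
  induction cells as [|A l IH]; intros Hw Hg; simpl; [lra|].
  inversion_clear Hw as [|? ? HA Hl]; inversion_clear Hg as [|? ? GA Gl].
  rewrite energy_app; apply Rplus_le_compat; [|apply IH; assumption].
  apply Rplus_le_compat.
  - unfold expand, cell_energy; rewrite energy_translate; unfold proto.
    destruct (fine A); [|simpl; lra].
    rewrite energy_block by exact HM.
    replace (2 * r * IZR (wgt A) ^ 2) with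
      (2 / INR M * IZR (wgt A) ^ 2 * (INR M * r)) by (field; lra).
    apply Rmult_le_compat_l; [|exact Hr].
    apply Rmult_le_pos; [|apply pow2_ge_0].
    apply Rlt_le, Rdiv_lt_0_compat; lra.
  - unfold period; rewrite inter_flat_map_r; apply sumL_le; intros B HB.
    rewrite Forall_forall in GA, Hl.
    rewrite <- (translate_0 (expand M B)); apply inter_cells; auto.
    rewrite Rplus_0_r, <- minus_IZR; apply IZR_le, GA, HB.
Qed.

Definition cross_energy (cells : list cell) (y : R) : R :=
  sumL (fun A => sumL (cell_coupling y A) cells) cells.

(** [gap_periodic] keeps successive periods apart, and [span_le] bounds the distance between cells
    [d] periods apart by [(d + 1) * L]. *)
Record pattern (L : Z) (cells : list cell) : Prop := Pattern {
  period_pos : (0 < L)%Z;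
  wgt_nonneg : Forall (fun A => (0 <= wgt A)%Z) cells;
  gap_ordered : ForallOrdPairs (fun A B => (gap A B <= ctr B - ctr A)%Z) cells;
  gap_periodic :
    forall A B, In A cells -> In B cells -> (gap A B <= ctr B + L - ctr A)%Z;
  span_le : forall A B, In A cells -> In B cells -> (ctr B - ctr A <= L)%Z
}.

Lemma gap_le_period (L : Z) (cells : list cell) (A B : cell) (d : nat) :
  pattern L cells -> In A cells -> In B cells -> (1 <= d)%nat ->
  IZR (gap A B) <= IZR (ctr B) + INR d * IZR L - IZR (ctr A).
Proof.
  intros H HA HB Hd; rewrite INR_IZR_INZ, <- mult_IZR, <- plus_IZR, <- minus_IZR.
  apply IZR_le; pose proof (gap_periodic _ _ H A B HA HB).
  pose proof (period_pos _ _ H); nia.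
Qed.

Lemma cross_energy_le (M : nat) (L : Z) (cells : list cell) (d : nat) :
  (1 <= M)%nat -> pattern L cells -> (1 <= d)%nat ->
  cross_energy cells (INR d * IZR L) <=
  inter (period M cells) (map (translate (INR d * IZR L)) (period M cells)).
Proof.
  intros HM H Hd; unfold cross_energy, period.
  rewrite map_flat_map, inter_flat_map_l.
  apply sumL_le; intros A HA; rewrite inter_flat_map_r.
  apply sumL_le; intros B HB.
  pose proof (wgt_nonneg _ _ H) as Hw; rewrite Forall_forall in Hw.
  apply inter_cells; auto; apply (gap_le_period _ cells); assumption.
Qed.

Lemma valid_period (M : nat) (cells : list cell) :
  (1 <= M)%nat -> Forall (fun A => (0 <= wgt A)%Z) cells ->
  Forall valid (period M cells).
Proof.
  intros HM H; apply Forall_flat_map; eapply Forall_impl; [|exact H].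
  intros A HA; apply valid_expand; assumption.
Qed.

Lemma apart_period (M : nat) (cells : list cell) :
  (1 <= M)%nat ->
  ForallOrdPairs (fun A B => (gap A B <= ctr B - ctr A)%Z) cells ->
  ForallOrdPairs apart (period M cells).
Proof.
  intros HM; induction 1 as [|A l HA Hl IH]; simpl; [constructor|].
  apply ForallOrdPairs_app; [apply apart_expand; exact HM|exact IH|].
  intros a b Ha Hb; apply in_flat_map in Hb as (B & HB & Hb).
  rewrite <- translate_0 in Hb.
  apply (apart_cells M 0 A B); auto.
  rewrite Forall_forall in HA.
  rewrite Rplus_0_r, <- minus_IZR; apply IZR_le, HA, HB.
Qed.

Lemma apart_period_translate (M : nat) (L : Z) (cells : list cell) (a b : point) :
  (1 <= M)%nat -> pattern L cells ->
  In a (period M cells) -> In b (period M cells) -> apart a (translate (IZR L) b).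
Proof.
  intros HM H Ha Hb.
  apply in_flat_map in Ha as (A & HA & Ha), Hb as (B & HB & Hb).
  apply (apart_cells M (IZR L) A B); auto using in_map.
  rewrite <- plus_IZR, <- minus_IZR; apply IZR_le, (gap_periodic _ _ H); assumption.
Qed.

Lemma energy_nonneg (l : list point) : Forall valid l -> 0 <= energy l.
Proof.
  induction 1 as [|a l Ha Hl IH]; simpl; [lra|].
  apply Rplus_le_le_0_compat; [|exact IH].
  rewrite Forall_forall in Hl; apply sumL_nonneg; intros b Hb.
  apply coupling_nonneg; auto.
Qed.

Lemma period_energy_nonneg (P : list point) (L : R) (k : nat) :
  Forall valid P -> 0 <= period_energy P L k.
Proof.
  intros V; apply energy_nonneg in V as H; apply Rplus_le_le_0_compat; [exact H|].
  rewrite <- (Rmult_0_r (INR k)), <- sum1_const; apply sum1_le; intros d _.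
  rewrite Forall_forall in V.
  apply sumL_nonneg; intros a Ha; rewrite sumL_map; apply sumL_nonneg; intros b Hb.
  apply coupling_nonneg; [apply V, Ha|exact (V b Hb)].
Qed.

(** Each denominator is at most [((d + 1) * L) ^ 2] by [span_le]; this is the form required by
    [sum1_tail_lower_bound]. *)
Lemma cross_energy_tail (L : Z) (cells : list cell) (d : nat) :
  pattern L cells -> (1 <= d)%nat ->
  sumL (fun A => sumL (fun B => IZR (coef A B)) cells) cells / IZR L ^ 2 /
    (INR d + 1) ^ 2 <= cross_energy cells (INR d * IZR L).
Proof.
  intros H Hd; unfold cross_energy.
  assert (HL : 0 < IZR L) by (apply IZR_lt, (period_pos _ _ H)).
  pose proof (pos_INR d) as Hd0.
  replace (_ / _ / _) with (sumL (fun A => sumL (fun B =>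
    / (IZR L ^ 2 * (INR d + 1) ^ 2) * IZR (coef A B)) cells) cells).
  2:{ rewrite (sumL_ext _ (fun A => / (IZR L ^ 2 * (INR d + 1) ^ 2) *
        sumL (fun B => IZR (coef A B)) cells)) by (intros; apply sumL_scal).
      rewrite sumL_scal; field; lra. }
  apply sumL_le; intros A HA; apply sumL_le; intros B HB.
  unfold cell_coupling, Rdiv; rewrite Rmult_comm.
  pose proof (wgt_nonneg _ _ H) as Hw; rewrite Forall_forall in Hw.
  apply Rmult_le_compat_l.
  - apply IZR_le; pose proof (Hw A HA); pose proof (Hw B HB).
    unfold coef; destruct (fine A), (fine B); nia.
  - pose proof (gap_le_period _ _ A B d H HA HB Hd) as Hg.
    assert (Hg0 : 2 <= IZR (gap A B)).
    { apply IZR_le; unfold gap; destruct (fine A), (fine B); lia. }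
    pose proof (IZR_le _ _ (span_le _ _ H A B HA HB)) as Hs; rewrite minus_IZR in Hs.
    rewrite <- Rpow_mult_distr; apply Rinv_le_contravar; [apply pow_lt; lra|].
    apply pow_incr; lra.
Qed.

(** * Rounded integer arithmetic for the numerical bounds *)

Fixpoint zsum {A : Type} (f : A -> Z) (l : list A) : Z :=
  match l with
  | [] => 0%Z
  | a :: l' => (f a + zsum f l')%Z
  end.

Lemma zsum_le {A : Type} (c : R) (f : A -> Z) (g : A -> R) (l : list A) :
  (forall a, In a l -> IZR (f a) <= c * g a) -> IZR (zsum f l) <= c * sumL g l.
Proof.
  induction l as [|a l IH]; simpl; intros H; [lra|].
  rewrite plus_IZR, Rmult_plus_distr_l; apply Rplus_le_compat; auto.
Qed.

Lemma zsum_IZR {A : Type} (f : A -> Z) (l : list A) :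
  sumL (fun a => IZR (f a)) l = IZR (zsum f l).
Proof. induction l as [|a l IH]; simpl; [|rewrite IH, plus_IZR]; reflexivity. Qed.

Lemma sum1_seq (N : nat) (f : nat -> R) : sum1 N f = sumL f (seq 1 N).
Proof.
  induction N as [|N IH]; [reflexivity|].
  rewrite seq_S, sumL_app, <- IH; simpl; ring.
Qed.

Lemma IZR_div_le (a b : Z) : (0 < b)%Z -> IZR (a / b) <= IZR a / IZR b.
Proof.
  intros Hb; apply (IZR_lt 0) in Hb as Hb'.
  apply Rmult_le_reg_r with (IZR b); [exact Hb'|].
  unfold Rdiv; rewrite Rmult_assoc, Rinv_l, Rmult_1_r by lra.
  rewrite <- mult_IZR; apply IZR_le; rewrite Z.mul_comm; apply Z.mul_div_le, Hb.
Qed.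

(** The coupling scaled by [s] and rounded down, so that large sums are computed in [Z] at a loss
    below [1 / s] per term. *)
Definition zcell_coupling (s y : Z) (A B : cell) : Z :=
  (s * coef A B / (ctr B + y - ctr A) ^ 2)%Z.

Lemma zcell_coupling_le (s y : Z) (A B : cell) : (0 < ctr B + y - ctr A)%Z ->
  IZR (zcell_coupling s y A B) <= IZR s * cell_coupling (IZR y) A B.
Proof.
  intros H; unfold zcell_coupling, cell_coupling.
  eapply Rle_trans; [apply IZR_div_le, Z.pow_pos_nonneg; lia|].
  rewrite mult_IZR, Z.pow_2_r, mult_IZR, minus_IZR, plus_IZR.
  right; unfold Rdiv; simpl; rewrite Rmult_1_r; ring.
Qed.

Definition zcross_energy (s : Z) (cells : list cell) (y : Z) : Z :=
  zsum (fun A => zsum (zcell_coupling s y A) cells) cells.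

Fixpoint zcells_energy (s : Z) (cells : list cell) : Z :=
  match cells with
  | [] => 0%Z
  | A :: l => (zsum (zcell_coupling s 0 A) l + zcells_energy s l)%Z
  end.

Lemma zcross_energy_le (s y : Z) (cells : list cell) :
  (forall A B, In A cells -> In B cells -> (0 < ctr B + y - ctr A)%Z) ->
  IZR (zcross_energy s cells y) <= IZR s * cross_energy cells (IZR y).
Proof.
  intros H; apply zsum_le; intros A HA; apply zsum_le; intros B HB.
  apply zcell_coupling_le; auto.
Qed.

Lemma zcells_energy_le (s : Z) (r : R) (cells : list cell) :
  ForallOrdPairs (fun A B => (gap A B <= ctr B - ctr A)%Z) cells ->
  IZR (zcells_energy s cells) + IZR s * sumL (cell_energy r) cells <=
  IZR s * cells_energy r cells.
Proof.
  induction 1 as [|A l HA Hl IH]; simpl; [lra|].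
  rewrite plus_IZR.
  assert (IZR (zsum (zcell_coupling s 0 A) l) <= IZR s * sumL (cell_coupling 0 A) l).
  { apply zsum_le; intros B HB; apply zcell_coupling_le.
    rewrite Forall_forall in HA; specialize (HA B HB).
    unfold gap in HA; destruct (fine A), (fine B); lia. }
  lra.
Qed.

(** * The concrete pattern and its numerical verification *)

(* The weights approximate the top eigenvector of the limiting form. *)
Definition cells0 : list cell :=
  [ Cell 0 false 166; Cell 20 false 166; Cell 40 false 165; Cell 60 false 166;
    Cell 80 false 166;
    Cell 101 true 969; Cell 103 true 895; Cell 105 true 843; Cell 107 true 806;
    Cell 109 true 784; Cell 111 true 773; Cell 113 true 773; Cell 115 true 784;
    Cell 117 true 806; Cell 119 true 843; Cell 121 true 895; Cell 123 true 969 ].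

(** The period is 144 = 80 + 20 + 24 + 20: the five points span [0, 80], the grid fills [100, 124],
    and a space of 20 separates them on either side. *)
Lemma pattern_cells0 : pattern 144 cells0.
Proof.
  assert (Hall : forall f : cell -> cell -> bool,
    forallb (fun A => forallb (f A) cells0) cells0 = true ->
    forall A B, In A cells0 -> In B cells0 -> f A B = true).
  { intros f H A B HA HB; rewrite forallb_forall in H; specialize (H A HA).
    rewrite forallb_forall in H; auto. }
  split; [lia| | | |].
  - repeat constructor; discriminate.
  - repeat constructor; discriminate.
  - intros A B HA HB; apply Z.leb_le; revert A B HA HB.
    apply Hall; vm_compute; reflexivity.
  - intros A B HA HB; apply Z.leb_le; revert A B HA HB.
    apply Hall; vm_compute; reflexivity.
Qed.

Lemma mass_period_cells0 (M : nat) : (1 <= M)%nat -> mass (period M cells0) = 19998804.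
Proof.
  intros HM; transitivity (sumL (fun A => mass (expand M A)) cells0);
    [apply sumL_flat_map|].
  rewrite (sumL_ext _ _ cells0 (fun A _ => mass_expand M A HM)), zsum_IZR.
  f_equal; vm_compute; reflexivity.
Qed.

(* [32898 / 10000] is a truncation of [PI ^ 2 / 3 = 2 * zeta 2]. *)
Lemma block_length_exists : exists M, (1 <= M)%nat /\
  INR M * (32898 / 10000) <= sum1 M (fun k => sum1 (pred k) (fun d => 2 / INR d ^ 2)).
Proof.
  set (f := fun d => 2 / INR d ^ 2).
  assert (Hf : forall d, 0 <= f d).
  { intros d; apply Rmult_le_pos; [lra|apply inv_pow2_nonneg]. }
  (* The first 300 terms, summed in units of 10^(-9), with the telescoped tail 2/302 in place of the
     rest. *)
  assert (Hn : 32898 / 10000 < sum1 300 f + 2 / (INR 300 + 2)).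
  { assert (H : IZR (zsum (fun d => 2 * 10 ^ 9 / Z.of_nat d ^ 2)%Z (seq 1 300)) <=
      IZR (10 ^ 9) * sum1 300 f).
    { rewrite sum1_seq; apply zsum_le; intros d Hd; apply in_seq in Hd.
      eapply Rle_trans; [apply IZR_div_le, Z.pow_pos_nonneg; lia|].
      unfold f; rewrite INR_IZR_INZ, mult_IZR, Z.pow_2_r, mult_IZR.
      right; unfold Rdiv; simpl (IZR _ ^ 2); rewrite Rmult_1_r; ring. }
    replace (INR 300) with 300 by (rewrite INR_IZR_INZ; reflexivity).
    match type of H with IZR ?z <= _ =>
      let v := eval vm_compute in z in
      replace z with v in H by (vm_compute; reflexivity) end.
    change (10 ^ 9)%Z with 1000000000%Z in H; lra. }
  apply (cesaro_lower_bound (fun k => sum1 k f) _ _ 2 300) with (4 := Hn); [|lra|].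
  - intros k; rewrite <- (Rmult_0_r (INR k)), <- sum1_const; apply sum1_le; auto.
  - intros k Hk.
    pose proof (pos_INR k).
    assert (2 / (INR k + 2) <= 2 / (INR k + 1)) by
      (apply Rmult_le_compat_l; [|apply Rinv_le_contravar]; lra).
    enough (sum1 300 f + 2 / (INR 300 + 2) - 2 / (INR k + 2) <= sum1 k f) by lra.
    apply sum1_tail_lower_bound; [lra| |exact Hk].
    intros d Hd; apply Rmult_le_compat_l; [lra|].
    assert (0 < INR d) by (apply lt_0_INR; lia).
    apply Rinv_le_contravar; [apply pow_lt; lra|apply pow_incr; lra].
Qed.

(** The decisive numerical inequality: internal energy, interaction with the next 30 periods, and
    the telescoped tail, compared with the mass 19998804 and with 3.1416 in place of pi. *)
Lemma cells_energy_cells0_bound :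
  35047 / 100000 * (31416 / 10000) ^ 2 * 19998804 <=
  cells_energy (32898 / 10000) cells0 +
  (sum1 30 (fun d => cross_energy cells0 (INR d * 144)) +
   sumL (fun A => sumL (fun B => IZR (coef A B)) cells0) cells0 / 144 ^ 2 /
     (INR 30 + 2)).
Proof.
  pose proof (zcells_energy_le 1000 (32898 / 10000) cells0
    (gap_ordered _ _ pattern_cells0)) as H1.
  assert (H2 : IZR (zsum (fun d => zcross_energy 1000 cells0 (Z.of_nat d * 144))
                 (seq 1 30)) <=
               1000 * sum1 30 (fun d => cross_energy cells0 (INR d * 144))).
  { rewrite sum1_seq; apply zsum_le; intros d Hd; apply in_seq in Hd.
    rewrite INR_IZR_INZ, <- mult_IZR; apply zcross_energy_le; intros A B HA HB.
    pose proof (gap_periodic _ _ pattern_cells0 A B HA HB).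
    unfold gap in *; destruct (fine A), (fine B); lia. }
  rewrite (sumL_ext _ (fun A => IZR (zsum (coef A) cells0)))
    by (intros; apply zsum_IZR).
  rewrite zsum_IZR.
  (* Evaluating every integer sum leaves a linear inequality between rationals for [lra]. *)
  repeat match goal with
  | |- context [IZR (zsum ?f ?l)] =>
      let v := eval vm_compute in (zsum f l) in
      replace (zsum f l) with v by (vm_compute; reflexivity)
  | H : context [zcells_energy ?s ?l] |- _ =>
      let v := eval vm_compute in (zcells_energy s l) in
      replace (zcells_energy s l) with v in H by (vm_compute; reflexivity)
  | H : context [IZR (zsum ?f ?l)] |- _ =>
      let v := eval vm_compute in (zsum f l) in
      replace (zsum f l) with v in H by (vm_compute; reflexivity)
  end.
  replace (INR 30) with 30 by (rewrite INR_IZR_INZ; reflexivity).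
  assert (H3 : sumL (cell_energy (32898 / 10000)) cells0 =
    32898 / 10000 * IZR (zsum (fun A => if fine A then 2 * wgt A ^ 2 else 0)%Z cells0)).
  { rewrite <- zsum_IZR, <- sumL_scal; apply sumL_ext; intros A _.
    unfold cell_energy; destruct (fine A); [|ring].
    rewrite Z.pow_2_r, !mult_IZR; ring. }
  match type of H3 with context [IZR (zsum ?f ?l)] =>
      let v := eval vm_compute in (zsum f l) in
      replace (zsum f l) with v in H3 by (vm_compute; reflexivity) end.
  lra.
Qed.

(* Cbar(1/2) >= 0.35047 pi^2: every admissible constant C(1/2) is at least
   0.35047 pi^2 (vacuous if none exists, i.e. Cbar = infinity). *)
Theorem theorem5 :
  forall C : R, admissible_const (1/2) C -> 35047 / 100000 * PI ^ 2 <= C.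
Proof.
  intros C HC.
  (* The mesh is fixed here, before the number [K] of periods is chosen. *)
  destruct block_length_exists as (M & HM & HMr).
  pose proof pattern_cells0 as Hpat.
  set (P := period M cells0).
  assert (HV : Forall valid P) by (apply valid_period; [exact HM|apply Hpat]).
  assert (HP : cells_energy (32898 / 10000) cells0 <= energy P) by
    (apply cells_energy_le; [exact HM|exact HMr|apply Hpat|apply Hpat]).
  pose (f := fun d => cross_energy cells0 (INR d * 144)).
  pose (G := sumL (fun A => sumL (fun B => IZR (coef A B)) cells0) cells0 / 144 ^ 2).
  pose (E0 := cells_energy (32898 / 10000) cells0 + (sum1 30 f + G / (INR 30 + 2))).
  assert (HE0 : 35047 / 100000 * (31416 / 10000) ^ 2 * 19998804 <= E0)
    by exact cells_energy_cells0_bound.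
  assert (HG : 0 <= G).
  { apply Rmult_le_pos; [|lra].
    apply sumL_nonneg; intros A HA; apply sumL_nonneg; intros B HB.
    pose proof (wgt_nonneg _ _ Hpat) as Hw; rewrite Forall_forall in Hw.
    apply IZR_le; pose proof (Hw A HA); pose proof (Hw B HB).
    unfold coef; destruct (fine A), (fine B); nia. }
  assert (Hlow : forall k, (30 <= k)%nat ->
    E0 - G / (INR k + 1) <= period_energy P 144 k).
  { intros k Hk; unfold period_energy.
    pose proof (pos_INR k).
    assert (G / (INR k + 2) <= G / (INR k + 1)) by
      (apply Rmult_le_compat_l; [exact HG|apply Rinv_le_contravar; lra]).
    assert (sum1 30 f + G / (INR 30 + 2) - G / (INR k + 2) <= sum1 k f).
    { apply sum1_tail_lower_bound; [exact HG| |exact Hk].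
      intros d Hd; apply (cross_energy_tail 144); [exact Hpat|lia]. }
    assert (sum1 k f <= sum1 k (fun d => inter P (map (translate (INR d * 144)) P))).
    { apply sum1_le; intros d Hd.
      apply (cross_energy_le M 144); [exact HM|exact Hpat|lia]. }
    unfold E0; lra. }
  assert (HCE : E0 <= C * 19998804).
  { destruct (Rle_lt_dec E0 (C * 19998804)) as [|Hlt]; [assumption|exfalso].
    (* If [E0] exceeded [C] times the mass of a period, the midpoint of the two would be a mean
       energy attained by some [K] periods, contradicting [energy_le_mass]. *)
    destruct (cesaro_lower_bound (period_energy P 144) E0
      ((E0 + C * 19998804) / 2) G 30) as (K & HK & HKE);
      [intros k; apply period_energy_nonneg, HV|exact HG|exact Hlow|lra|].
    rewrite <- energy_array in HKE.
    assert (HA : energy (array P 144 K) <= C * mass (array P 144 K)).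
    { apply energy_le_mass; [exact HC| |apply valid_array, HV].
      apply apart_array; [lra|apply apart_period; [exact HM|apply Hpat]|].
      intros a b; apply (apart_period_translate M 144 cells0 a b HM Hpat). }
    rewrite mass_array in HA; unfold P in HA at 2; rewrite mass_period_cells0 in HA
      by exact HM.
    assert (0 < INR K) by (apply lt_0_INR; lia).
    nra. }
  assert (PI ^ 2 <= (31416 / 10000) ^ 2).
  { apply pow_incr; split; [apply Rlt_le, PI_RGT_0|apply PI_le]. }
  lra.
Qed.
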